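(* The three axioms ''non-zero'', ''irreducible'' and ''free'' are independent, in the following sense. For each one of these three axioms there exists a simplicial cup-$i$ construction that satisfies the other two axioms and is not isomorphic to the canonical cup-$i$ construction $\triangle^{\mathrm{cn}}$.
   Context: **Chains.** $\mathbb{F}_2$ is the field with two elements. A semi-simplicial set is a contravariant functor from the injective simplex category to sets. For a semi-simplicial set $X$, $N(X)$ is the chain complex over $\mathbb{F}_2$ with basis the simplices of $X$; for a simplicial set, $N(X)$ denotes normalized chains. $N^\vee(X)=\mathrm{Hom}(N(X),\mathbb{F}_2)$, graded homologically (in non-positive degrees). $\Delta^n$ is the standard $n$-simplex, with face simplices the non-empty subsets of $\{0,\dots,n\}$; $N(\Delta^n)$ is the same complex in both settings. Simplices are identified with the corresponding basis elements of chains and (dual) cochains; $|x|$ is the dimension of $x$. **Cup-$i$ structures.** Let $\mathbb{S}_2$ be the group with one non-identity element $T$ and let $W$ be the complex with $W_i=\mathbb{F}_2[\mathbb{S}_2]\{e_i\}$, $i\ge 0$, and $\partial e_i=(1+T)e_{i-1}$. A cup-$i$ product structure on a chain complex $A$ is a chain map $W\otimes_{\mathbb{F}_2[\mathbb{S}_2]}A^{\otimes 2}\to A$, where $T$ acts by transposition on $A^{\otimes2}$ and by right multiplication on $W$; the image of $e_i\otimes\alpha\otimes\beta$ is $\alpha\smile_i\beta$. An isomorphism between two such structures on $A$ is an automorphism $\phi$ of the $\mathbb{F}_2[\mathbb{S}_2]$-complex $W$ (given by choices $\phi(e_i)\in\{e_i,Te_i\}$) such that precomposing one structure map with $\phi\otimes\mathrm{id}$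 gives the other. **Constructions.** A semi-simplicial (resp. simplicial) cup-$i$ construction is a cup-$i$ product structure on $N^\vee(X)$ for every semi-simplicial (resp. simplicial) set $X$, natural in $X$. An isomorphism of constructions is a family of cup-$i$ isomorphisms natural in $X$ (so given by one common automorphism of $W$). A semi-simplicial construction is determined by its restriction to the $\Delta^n$; it is simplicial if the cup-$i$ product structures on $N^\vee(\Delta^n)$, $n\ge0$, are natural with respect to all maps of the simplex category, including codegeneracies. Dually, a semi-simplicial construction is the same as elements $\triangle_i[n]\in N(\Delta^n)^{\otimes2}_{n+i}$ ($i,n\ge0$) such that the induced natural maps $\triangle_i\colon N(\Delta^n)\to N(\Delta^n)^{\otimes 2}$ (sending a face to the image of the corresponding element) satisfy $\partial\triangle_i+\triangle_i\partial=(1+T)\triangle_{i-1}$ with $\triangle_{-1}=0$; the correspondence is $\alpha\smile_i\beta=(\alpha\otimes\beta)\circ\triangle_i$. **Axioms.** The zero construction assigns the zero map to every $X$; any other is non-zero. A construction is irreducible if for all $i,N\ge0$ and any simplex $x$ of $\Delta^N$, $(y^{(1)}\smile_i y^{(2)})(x)=0$ whenever $y$ is a proper face of $x$ and $y^{(1)},y^{(2)}$ are faces of $y$. It is free if for all $i,N\ge0$ and any simplices $x,x'$ of $\Delta^N$ with $|x|\ne i$ or $|x'|\neq i$, the equality $x\smile_i x'=x'\smile_i x$ implies $x\smile_i x'=0$. **Canonical construction.** For $U\subseteq\{0,\dots,n\}$ a proper subset let $d_U[n]$ be the face of $\Delta^n$ with vertex set $\{0,\dots,n\}\setminus U$. For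 $U=\{u_1<\dots<u_{n-i}\}$ and $\varepsilon\in\{0,1\}$ let $U^\varepsilon=\{u_j\in U : u_j+j\equiv\varepsilon \bmod 2\}$. The canonical construction is given by $\triangle^{\mathrm{cn}}_i[n]=\sum_{U\subseteq\{0,\dots,n\},\,|U|=n-i} d_{U^0}[n]\otimes d_{U^1}[n]$ for $0\le i\le n$ and $\triangle^{\mathrm{cn}}_i[n]=0$ for $i>n$. It is known that this defines a semi-simplicial cup-$i$ construction. *)

(* Defs.v *)
From HB Require Import structures.
From mathcomp Require Import all_boot all_order all_algebra.
From mathcomp Require Import boolp functions zify.

Set Implicit Arguments.
Unset Strict Implicit.
Unset Printing Implicit Defensive.

Import GRing.Theory.
Local Open Scope ring_scope.

(* The object [n] of the simplex category is 'I_n.+1.                         *)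

Definition strict_mono m n (f : {ffun 'I_m.+1 -> 'I_n.+1}) : bool :=
  [forall i : 'I_m.+1, forall j : 'I_m.+1, (i < j)%N ==> (f i < f j)%N].

Definition weak_mono m n (f : {ffun 'I_m.+1 -> 'I_n.+1}) : bool :=
  [forall i : 'I_m.+1, forall j : 'I_m.+1, (i <= j)%N ==> (f i <= f j)%N].

Definition injMap m n := {f : {ffun 'I_m.+1 -> 'I_n.+1} | strict_mono f}.

Definition monoMap m n := {f : {ffun 'I_m.+1 -> 'I_n.+1} | weak_mono f}.

Lemma strict_mono_id n : strict_mono [ffun i : 'I_n.+1 => i].
Proof. by apply/forallP=> i; apply/forallP=> j; rewrite !ffunE implybb. Qed.

Definition id_inj n : injMap n n := Sub _ (strict_mono_id n).

Lemma strict_mono_comp k m n (g : injMap m n) (f : injMap k m) :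
  strict_mono [ffun i => val g (val f i)].
Proof.
apply/forallP=> i; apply/forallP=> j; apply/implyP=> lt_ij; rewrite !ffunE.
apply: (implyP (forallP (forallP (valP g) _) _)).
exact: (implyP (forallP (forallP (valP f) _) _)).
Qed.

Definition comp_inj k m n (g : injMap m n) (f : injMap k m) : injMap k n :=
  Sub _ (strict_mono_comp g f).

Lemma strict_mono_coface n (j : 'I_n.+2) :
  strict_mono [ffun i : 'I_n.+1 => lift j i].
Proof.
apply/forallP=> i; apply/forallP=> k; apply/implyP=> lt_ik.
by rewrite !ffunE /= ltnNge leq_bump2 -ltnNge.
Qed.

Definition coface n (j : 'I_n.+2) : injMap n n.+1 :=
  Sub _ (strict_mono_coface j).

(* Semi-simplicial sets: [act X f x] is the image of x under X(f).            *)

Record ssSet := SsSet {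
  simp : nat -> Type;
  act : forall m n, injMap m n -> simp n -> simp m;
  act_id : forall n (x : simp n), act (id_inj n) x = x;
  act_comp : forall k m n (g : injMap m n) (f : injMap k m) (x : simp n),
    act (comp_inj g f) x = act f (act g x)
}.

Arguments act X {m n} f x : rename.

Record ssMap (X Y : ssSet) := SsMap {
  smap : forall n, simp X n -> simp Y n;
  smap_act : forall m n (f : injMap m n) (x : simp X n),
    smap (act X f x) = act Y f (smap x)
}.

Arguments smap {X Y} f {n} x : rename.

Lemma comp_inj_id k n (x : injMap k n) : comp_inj x (id_inj k) = x.
Proof. by apply: val_inj; apply/ffunP=> i; rewrite !ffunE. Qed.

Lemma comp_injA j k m n (h : injMap m n) (g : injMap k m) (f : injMap j k) :
  comp_inj h (comp_inj g f) = comp_inj (comp_inj h g) f.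
Proof. by apply: val_inj; apply/ffunP=> i; rewrite !ffunE. Qed.

(* The k-simplices of Delta^n are the strictly increasing maps [k] -> [n]; such
   a map is identified with the non-empty subset [vset x] of {0,...,n}.       *)
Definition Delta n : ssSet :=
  @SsSet (fun k => injMap k n) (fun _ _ f x => comp_inj x f)
    (fun k x => comp_inj_id x) (fun _ _ _ g f x => comp_injA x g f).

Definition vset k n (x : injMap k n) : {set 'I_n.+1} := [set val x i | i : 'I_k.+1].

(* Complexes over F_2 in non-positive homological degrees: [obj A n] is the
   part of homological degree -n.                                             *)

Record f2complex := Complex {
  obj :> nat -> lmodType 'F_2;
  diff : forall n, {linear obj n -> obj n.+1};
  diff_diff : forall n (a : obj n), diff n.+1 (diff n a) = 0
}.

Arguments diff A {n} : rename.

(* N(X)_n has basis X_n, so N^\vee(X)_{-n} is the space of all functions on X_n. *)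
Definition cochain (X : ssSet) n : lmodType 'F_2 := (simp X n -> ('F_2)^o).

Definition coboundary X n (a : cochain X n) : cochain X n.+1 :=
  fun x => \sum_(j < n.+2) a (act X (coface j) x).

Lemma coboundary_linear X n : linear (@coboundary X n).
Proof.
move=> c a b; apply/funext=> x; rewrite /coboundary !fctE /= scaler_sumr.
by rewrite -big_split.
Qed.

HB.instance Definition _ X n :=
  GRing.isLinear.Build 'F_2 (cochain X n) (cochain X n.+1) _ (@coboundary X n)
    (@coboundary_linear X n).

Lemma coboundary_coboundary X n (a : cochain X n) :
  coboundary (coboundary a) = 0.
Proof.
apply/funext=> x; rewrite /coboundary [RHS]/(0 : 'F_2).
pose F (p : 'I_n.+3 * 'I_n.+2) : 'F_2 :=
  a (act X (comp_inj (coface p.1) (coface p.2)) x).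
transitivity (\sum_p F p).
  rewrite pair_bigA; apply: eq_bigr => -[j i] _ /=.
  by rewrite /F /= act_comp.
rewrite (bigID (fun p : 'I_n.+3 * 'I_n.+2 => (p.2 < p.1)%N)) /=.
pose h (p : 'I_n.+3 * 'I_n.+2) : 'I_n.+3 * 'I_n.+2 := (lift ord0 p.2, inord p.1).
pose h' (p : 'I_n.+3 * 'I_n.+2) : 'I_n.+3 * 'I_n.+2 := (inord p.2, inord p.1.-1).
rewrite (reindex_onto h h') /=; last first.
  move=> [j i] /= lt_ij; have := ltn_ord j; have := ltn_ord i => lti ltj.
  have j1 : (j.-1 < n.+2)%N by lia.
  congr pair; apply: val_inj; rewrite /= ?inordK //= ?/bump; lia.
rewrite (eq_bigl (fun p : 'I_n.+3 * 'I_n.+2 => ~~ (p.2 < p.1)%N)); last first.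
  move=> [j i] /=; have := ltn_ord j; have := ltn_ord i => lti ltj.
  rewrite -leqNgt; case: (leqP j i) => [le_ji|lt_ij].
    have j1 : (j < n.+2)%N by lia.
    apply/andP; split; first by rewrite inordK // /bump; lia.
    apply/eqP; congr pair; apply: val_inj; rewrite /= ?inordK //= ?inordK //; lia.
  apply/negP=> /andP[+ /eqP[/(congr1 val) + _]] /=.
  case: (ltnP j n.+2) => j1; first by rewrite inordK // /bump; lia.
  have := ltn_ord (inord j : 'I_n.+2) => lt_j _.
  by rewrite /= inordK; lia.
rewrite -big_split big1 //= => -[j i] /=; rewrite -leqNgt => le_ji.
suff -> : F (h (j, i)) = F (j, i) by rewrite -mulr2n -mulr_natr pchar_Zp ?mulr0.
congr (a (act X _ x)); apply: val_inj; apply/ffunP=> k; rewrite !ffunE.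
apply: val_inj => /=; have := ltn_ord i => lti.
rewrite inordK /bump; lia.
Qed.

Definition Nvee (X : ssSet) : f2complex :=
  @Complex (cochain X) (fun n => @coboundary X n) (@coboundary_coboundary X).

Definition pull X Y (f : ssMap X Y) n (a : Nvee Y n) : Nvee X n :=
  fun x => a (smap f x).

(* The map induced by a weakly monotone f on normalized cochains of standard
   simplices: f sends a simplex with degenerate image to 0.                   *)
Definition pull_mono m n (f : monoMap m n) p (a : Nvee (Delta n) p) :
    Nvee (Delta m) p :=
  fun x => if (insub [ffun i => val f (val x i)] : option (injMap p n)) is Some y
           then a y else 0.

(* F_2[S_2]; the pair (a, b) stands for a + b T.                              *)
Definition F2S2 : lmodType 'F_2 := (('F_2)^o * ('F_2)^o)%type.

Definition F2S2_one : F2S2 := (1, 0).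
Definition mulT (w : F2S2) : F2S2 := (w.2, w.1).

(* Each W_i is a copy of F_2[S_2], w standing for w e_i; [Wdiff i] is the
   differential W_i.+1 -> W_i.                                                *)
Definition W (i : nat) : lmodType 'F_2 := F2S2.
Definition Wdiff i (w : W i.+1) : W i := w + mulT w.

Record W_aut (phi : forall i, W i -> W i) : Prop := WAut {
  W_aut_linear : forall i, linear (phi i);
  W_aut_bij : forall i, bijective (phi i);
  W_aut_equiv : forall i w, phi i (mulT w) = mulT (phi i w);
  W_aut_diff : forall i (w : W i.+1), phi i (Wdiff w) = Wdiff (phi i.+1 w)
}.

(* The component of the structure map taking w e_i (x) a (x) b, with a and b of
   degree -p and -q, to degree -r.                                            *)
Definition cupMap (A : f2complex) :=
  forall i p q r, W i -> A p -> A q -> A r.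

(* The degree -r part of the boundary of an element with components [c s].    *)
Definition diff_at (A : f2complex) (c : forall s, A s) (r : nat) : A r :=
  if r is s.+1 return A r then diff A (c s) else 0.

(* Chain maps W (x)_{F_2[S_2]} A (x) A -> A, as trilinear maps which are
   homogeneous, balanced over F_2[S_2] and compatible with the differentials.
   The target degree i - p - q is positive when p + q < i; A vanishes there,
   and [cup_chain] at r = 0 covers the boundary relations from degree 1.      *)
Record is_cup (A : f2complex) (mu : cupMap A) : Prop := IsCup {
  cup_linear1 : forall i p q r a b, linear (fun w => mu i p q r w a b);
  cup_linear2 : forall i p q r w b, linear (fun a => mu i p q r w a b);
  cup_linear3 : forall i p q r w a, linear (mu i p q r w a);
  cup_degree : forall i p q r w a b,
    (p + q != r + i)%N -> mu i p q r w a b = 0;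
  cup_balanced : forall i p q r w a b,
    mu i p q r (mulT w) a b = mu i q p r w b a;
  cup_chain : forall i p q r (w : W i) (a : A p) (b : A q),
    diff_at (fun s => mu i p q s w a b) r =
      (if i is j.+1 return W i -> A r then fun w => mu j p q r (Wdiff w) a b
       else fun=> 0) w
      + mu i p.+1 q r w (diff A a) b + mu i p q.+1 r w a (diff A b)
}.

(* The degree -r component of the cup-i product.                              *)
Definition cup A (mu : cupMap A) i p q (a : A p) (b : A q) r : A r :=
  mu i p q r F2S2_one a b.

Arguments cup {A} mu i {p q} a b r.

Definition cupFamily := forall X : ssSet, cupMap (Nvee X).

Record ss_construction (M : cupFamily) : Prop := SsConstruction {
  constr_cup : forall X, is_cup (M X);
  constr_nat : forall X Y (f : ssMap X Y) i p q r w
      (a : Nvee Y p) (b : Nvee Y q),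
    pull f (M Y i p q r w a b) = M X i p q r w (pull f a) (pull f b)
}.

Definition is_simplicial (M : cupFamily) : Prop :=
  forall m n (f : monoMap m n) i p q r w
      (a : Nvee (Delta n) p) (b : Nvee (Delta n) q),
    pull_mono f (M (Delta n) i p q r w a b) =
    M (Delta m) i p q r w (pull_mono f a) (pull_mono f b).

Definition isomorphic (M M' : cupFamily) : Prop :=
  exists2 phi, W_aut phi &
    forall X i p q r w (a : Nvee X p) (b : Nvee X q),
      M X i p q r (phi i w) a b = M' X i p q r w a b.

Definition is_nonzero (M : cupFamily) : Prop :=
  ~ (forall X i p q r w a b, M X i p q r w a b = 0).

(* x as a cochain. *)
Definition dual_basis p n (x : injMap p n) : Nvee (Delta n) p :=
  fun y => (y == x)%:R.

Definition is_irreducible (M : cupFamily) : Prop :=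
  forall i n k l p q (x : injMap k n) (y : injMap l n)
      (y1 : injMap p n) (y2 : injMap q n),
    vset y \proper vset x -> vset y1 \subset vset y -> vset y2 \subset vset y ->
    cup (M (Delta n)) i (dual_basis y1) (dual_basis y2) k x = 0.

Definition is_free (M : cupFamily) : Prop :=
  forall i n p q (x : injMap p n) (x' : injMap q n),
    p <> i \/ q <> i ->
    (forall r, cup (M (Delta n)) i (dual_basis x) (dual_basis x') r =
               cup (M (Delta n)) i (dual_basis x') (dual_basis x) r) ->
    forall r, cup (M (Delta n)) i (dual_basis x) (dual_basis x') r = 0.

(* A family of elements triangle_i[n] of N(Delta^n) (x) N(Delta^n), given by
   their coefficients at y (x) z.                                             *)
Definition coproducts :=
  forall (i n p q : nat), injMap p n -> injMap q n -> 'F_2.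

(* a cup_i b = (a (x) b) o triangle_i, evaluated on an r-simplex x.           *)
Definition cup_of (D : coproducts) X i p q (a : Nvee X p) (b : Nvee X q) r :
    Nvee X r :=
  fun x => \sum_(y : injMap p r) \sum_(z : injMap q r)
    D i r p q y z * (a (act X y x) * b (act X z x)).

Arguments cup_of D {X} i {p q} a b r x.

Definition family_of (D : coproducts) : cupFamily :=
  fun X i p q r w a b =>
    w.1 *: cup_of D i a b r + w.2 *: cup_of D i b a r.

(* The elements of U are u_1 < u_2 < ...; the index of u is
   #|{v in U | v <= u}|.                                                      *)
Definition parity_part n (U : {set 'I_n}) (e : bool) : {set 'I_n} :=
  [set u in U | odd (u + #|[set v in U | (v <= u)%N]|) == e].

(* The pair (y, z) = (d_{U^0}[n], d_{U^1}[n]) is characterized by its vertex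
   sets.                                                                      *)
Definition canonical_coproducts : coproducts :=
  fun i n p q y z =>
    \sum_(U : {set 'I_n.+1} | (#|U| + i == n)%N)
      ((vset y == ~: parity_part U false) &&
       (vset z == ~: parity_part U true))%:R.

Definition canonical : cupFamily := family_of canonical_coproducts.

(* Main.v *)
Require Import Defs.
From HB Require Import structures.
From mathcomp Require Import all_boot all_order all_algebra.
From mathcomp Require Import boolp functions zify ring.
(* Restores [canonical], which boolp shadows. *)
Import Defs.

Set Implicit Arguments.
Unset Strict Implicit.
Unset Printing Implicit Defensive.

Import GRing.Theory.
Local Open Scope ring_scope.

(** A pair of faces [y, z] of Delta^n is a word of length n + 1 over four
    letters: L, R, B, O for a vertex in [y] only, [z] only, both, or neither.
    The canonical pairs are the words without O which, read from the left,
    have L after an even and R after an odd number of Bs.  Prepending a letter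
    to a word gives the identity [boundary of triangle_i = (1 + T)
    triangle_(i-1)] by induction, for the words starting in either state.

    - Without "non-zero": the zero construction.
    - Without "free": [(1 + T) triangle_0] in degree 0 and zero in positive
      degrees: a chain map killed by [1 + T], because [(1 + T)^2 = 0].
    - Without "irreducible": for a map [h] of degree 1, adding [[boundary, h]]
      to [triangle_0] and [(1 + T) h] to [triangle_1] gives a construction.
      Take [h] supported on 3-simplices with value the word LLBB: the boundary
      contains OLBB, which misses a vertex.  Only words of length 4 and 5 are
      affected in degree 0, so freeness is a finite check. *)

(** * Words and the boundary of coefficient functions on words *)

Lemma F2_two : 2 = 0 :> 'F_2.
Proof. exact: val_inj. Qed.

Lemma F2_addxx (x : 'F_2) : x + x = 0.
Proof. ring: F2_two. Qed.

Lemma add_eq0 (x y : 'F_2) : x = 0 -> y = 0 -> x + y = 0.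
Proof. by move=> -> ->; rewrite addr0. Qed.

Definition letter := (bool * bool)%type.

Local Notation lO := (false, false).
Local Notation lL := (true, false).
Local Notation lR := (false, true).
Local Notation lB := (true, true).

Definition swap_word (s : seq letter) : seq letter := [seq (l.2, l.1) | l <- s].

Definition del (T : Type) k (s : seq T) := take k s ++ drop k.+1 s.

Definition add1 k (s : seq letter) := set_nth lO s k (true, (nth lO s k).2).
Definition add2 k (s : seq letter) := set_nth lO s k ((nth lO s k).1, true).

(* The coefficient of [y (x) z] in the boundary of a map with coefficients [f]:
   the word is a face of those with a vertex added to [y] or to [z], and it
   comes from a facet of the simplex when a vertex is in neither. *)
Definition wdiff_at (f : seq letter -> 'F_2) (s : seq letter) k : 'F_2 :=
  (~~ (nth lO s k).1)%:R * f (add1 k s) + (~~ (nth lO s k).2)%:R * f (add2 k s)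
  + (nth lO s k == lO)%:R * f (del k s).

Definition wdiff f s : 'F_2 := \sum_(0 <= k < size s) wdiff_at f s k.

(** The term at position 0, split off so that boundaries can be computed by recursion on the
    word. *)
Definition wdiff_head (f : seq letter -> 'F_2) (l : letter) s : 'F_2 :=
  match l with
  | lO => f (lL :: s) + f (lR :: s) + f s
  | lL | lR => f (lB :: s)
  | lB => 0
  end.

Lemma wdiff_nil f : wdiff f [::] = 0.
Proof. by rewrite /wdiff big_geq. Qed.

Lemma wdiff_cons f l s :
  wdiff f (l :: s) = wdiff_head f l s + wdiff (fun t => f (l :: t)) s.
Proof.
rewrite /wdiff /= big_nat_recl //; congr (_ + _).
by case: l => [[] []]; rewrite /wdiff_at /add1 /add2 /= /del /= drop0; ring.
Qed.

Lemma eq_wdiff f g : f =1 g -> wdiff f =1 wdiff g.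
Proof. by move=> /funext ->. Qed.

Lemma wdiff0 s : wdiff (fun=> 0) s = 0.
Proof. by rewrite /wdiff big1 // => k _; rewrite /wdiff_at; ring. Qed.

Lemma wdiffD f g s : wdiff (fun t => f t + g t) s = wdiff f s + wdiff g s.
Proof.
rewrite /wdiff -big_split; apply: eq_bigr => k _; rewrite /wdiff_at /=; ring.
Qed.

Lemma wdiffZ a f s : wdiff (fun t => a * f t) s = a * wdiff f s.
Proof.
by rewrite /wdiff mulr_sumr; apply: eq_bigr => k _; rewrite /wdiff_at; ring.
Qed.

Lemma wdiff_swap f s :
  wdiff (fun t => f (swap_word t)) s = wdiff f (swap_word s).
Proof.
elim: s f => [|l s IH] f; first by rewrite !wdiff_nil.
rewrite !wdiff_cons (IH (fun t => f ((l.2, l.1) :: t))); congr (_ + _).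
by rewrite /swap_word; case: l => [[] []] //=; ring.
Qed.

(** Induction kills the terms acting twice on the tail. The mixed terms, head then tail and tail
    then head, cancel modulo 2, and so do the two ways of filling a head O up to B. *)
Lemma wdiff_wdiff f s : wdiff (wdiff f) s = 0.
Proof.
elim: s f => [|l s IH] f; first by rewrite wdiff_nil.
rewrite wdiff_cons (eq_wdiff (wdiff_cons f l)) wdiffD IH.
by case: l => [[] []] /=; rewrite ?wdiff_cons ?wdiffD ?wdiff0 /=; ring: F2_two.
Qed.

(** * Compatibility with codegeneracies, on words *)

(* The sum over the words that an elementary codegeneracy sends, without
   degeneracies, to a word with the letter [l] at the collapsed vertex. *)
Definition collapse (f : seq letter -> 'F_2) (l : letter) s : 'F_2 :=
  match l with
  | lO => f [:: lO, lO & s]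
  | lL => f [:: lL, lO & s] + f [:: lO, lL & s]
  | lR => f [:: lR, lO & s] + f [:: lO, lR & s]
  | lB => f [:: lL, lR & s] + f [:: lR, lL & s] +
          (f [:: lB, lO & s] + f [:: lO, lB & s])
  end.

(** Collapsing two adjacent vertices makes a simplex degenerate, hence zero in normalized chains, so
    its coproduct has to collapse to zero. *)
Definition degen_compat (f : seq letter -> 'F_2) :=
  forall s1 l s2, collapse (fun t => f (s1 ++ t)) l s2 = 0.

Lemma degen_compat_cons f l : degen_compat f -> degen_compat (fun t => f (l ::
  t)).
Proof. by move=> df s1; apply: (df (l :: s1)). Qed.

Lemma collapseZ a f l s : collapse (fun t => a * f t) l s = a * collapse f l s.
Proof. by case: l => [[] []] /=; ring. Qed.

Lemma collapseD f g l s :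
  collapse (fun t => f t + g t) l s = collapse f l s + collapse g l s.
Proof. by case: l => [[] []] /=; ring. Qed.

Lemma degen_compatD f g :
  degen_compat f -> degen_compat g -> degen_compat (fun t => f t + g t).
Proof.
by move=> df dg s1 l s2; rewrite collapseD df dg addr0.
Qed.

Lemma degen_compat0 : degen_compat (fun=> 0).
Proof. by move=> s1 [[] []] s2 /=; rewrite ?addr0. Qed.

Lemma degen_compat_swap f :
  degen_compat f -> degen_compat (fun t => f (swap_word t)).
Proof.
move=> df s1 l s2; have := df (swap_word s1) (l.2, l.1) (swap_word s2).
rewrite /swap_word; case: l => [[] []] /=; rewrite !map_cat //= => <-; ring.
Qed.

(** Collapsing is a chain map. Boundary terms away from the collapsed vertex are a boundary of
    collapses. Those at the vertex form the collapses for the letters that fill it further: B for L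
    and R, both L and R for O. *)
Lemma degen_compat_wdiff f : degen_compat f -> degen_compat (wdiff f).
Proof.
move=> df s1; elim: s1 f df => [|x s1 IH] f df l s2.
  have dl l' := df [::] l' s2; move: (dl lB) (dl lL) (dl lR) => /= eB eL eR.
  have e0 l' : wdiff (collapse f l') s2 = 0.
    by rewrite (eq_wdiff (df [::] l')) wdiff0.
  move: (e0 l); case: l => [[] []] /=; rewrite ?wdiffD !wdiff_cons /= => e.
  - by apply: etrans e; ring: F2_two.
  - by apply: etrans (add_eq0 e eB); ring: F2_two.
  - by apply: etrans (add_eq0 e eB); ring: F2_two.
  by rewrite e; apply: etrans (add_eq0 eL eR); ring: F2_two.
have dh : degen_compat (wdiff_head f x).
  case: x => [[] []] /=; first exact: degen_compat0.
  - exact: degen_compat_cons.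
  - exact: degen_compat_cons.
  by do 2?[apply: degen_compatD => //]; apply: degen_compat_cons.
have := IH _ (degen_compat_cons x df) l s2; have := dh s1 l s2.
case: l => [[] []] /= e1 e2; rewrite !wdiff_cons.
all: by apply: etrans (add_eq0 e1 e2); ring.
Qed.

(** * The canonical words *)

Fixpoint alt_word (e : bool) (s : seq letter) : bool :=
  if s is l :: t then
    match l with
    | lB => alt_word (~~ e) t
    | lL => ~~ e && alt_word e t
    | lR => e && alt_word e t
    | lO => false
    end
  else true.

(** Without O, a pair of total dimension [n + i] on an n-simplex has [i + 1] letters B, so the
    canonical [triangle_i] is [alt_coef i.+1 false]. *)
Definition alt_coef k e s : 'F_2 := (alt_word e s && (count_mem lB s == k))%:R.

Lemma alt_coef_cons k e l s :
  alt_coef k e (l :: s) =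
    match l with
    | lB => if k is k'.+1 then alt_coef k' (~~ e) s else 0
    | lL => (~~ e)%:R * alt_coef k e s
    | lR => e%:R * alt_coef k e s
    | lO => 0
    end.
Proof.
rewrite /alt_coef /=; case: l => [[] []] //=; rewrite ?add0n.
- by case: k => [|k]; rewrite ?andbF // add1n.
- by case: e; rewrite ?mul0r ?mul1r.
- by case: e; rewrite ?mul0r ?mul1r.
Qed.

(** The induction needs both states and all [k], since stripping a B flips the state and lowers [k].
    At a head O, filling it with the one letter that the state admits cancels deleting it. The state
    [~~ e] is the transpose by [alt_coef_swap], so the right side is [1 + T] applied one degree
    lower. *)
Lemma wdiff_alt_coef k e s :
  wdiff (alt_coef k e) s =
    if k is k'.+1 then alt_coef k' e s + alt_coef k' (~~ e) s else 0.
Proof.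
elim: s k e => [|l s IH] k e.
  by rewrite wdiff_nil; case: k => [|k] //; rewrite F2_addxx.
rewrite wdiff_cons (eq_wdiff (alt_coef_cons k e l)).
case: l => [[] []] /=; rewrite ?alt_coef_cons ?wdiff0.
- case: k => [|k]; rewrite ?wdiff0 ?addr0 // IH negbK.
  by case: k => [|k]; rewrite add0r !alt_coef_cons ?negbK; ring.
- by rewrite wdiffZ IH; case: k => [|k]; case: e;
  rewrite /= ?alt_coef_cons /=; ring: F2_two.
- by rewrite wdiffZ IH; case: k => [|k]; case: e;
  rewrite /= ?alt_coef_cons /=; ring: F2_two.
by case: k => [|k]; case: e => /=; ring: F2_two.
Qed.

(** Each word in a collapse contains an O or an L next to an R. A canonical word contains neither,
    since only a B changes the state. *)
Lemma degen_compat_alt_coef k e : degen_compat (alt_coef k e).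
Proof.
move=> s1; elim: s1 k e => [|x s1 IH] k e l s2.
  by case: l => [[] []] /=; rewrite !alt_coef_cons ?addr0 //;
    case: k => [|k]; case: e; rewrite /= ?alt_coef_cons /=; ring.
have -> : (fun t => alt_coef k e ((x :: s1) ++ t)) =
          (fun t => alt_coef k e (x :: (s1 ++ t))) by [].
rewrite (funext (fun t => alt_coef_cons k e x (s1 ++ t))).
case: x => [[] []].
- case: k => [|k]; last exact: IH.
  exact: (degen_compat0 [::]).
- by rewrite collapseZ IH mulr0.
- by rewrite collapseZ IH mulr0.
exact: (degen_compat0 [::]).
Qed.

Lemma alt_coef_swap k e s : alt_coef k e (swap_word s) = alt_coef k (~~ e) s.
Proof.
elim: s k e => [|l s IH] k e //; rewrite [swap_word _]/= !alt_coef_cons.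
by case: l k => [[] []] [|k] //=; rewrite ?IH ?negbK.
Qed.

Lemma alt_coef_symmetric k s :
  alt_coef k false s != 0 -> alt_coef k true s != 0 -> s = nseq k lB.
Proof.
elim: s k => [|l s IH] k.
  by rewrite /alt_coef /=; case: k.
rewrite !alt_coef_cons; case: l => [[] []]; rewrite ?mul0r ?eqxx //.
by case: k => [|k]; rewrite ?eqxx //= => h1 h2; rewrite (IH k).
Qed.

Lemma alt_coef_lO k e s : lO \in s -> alt_coef k e s = 0.
Proof.
elim: s k e => [|l s IH] k e //; rewrite inE alt_coef_cons => /orP[/eqP <-
  //|ins].
by case: l k ins => [[] []] [|k] ins //; rewrite ?IH ?mulr0.
Qed.

(** * Words of pairs of vertex sets *)

Definition word_of n (A B : {set 'I_n.+1}) : seq letter :=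
  [seq (j \in A, j \in B) | j <- enum 'I_n.+1].

Section WordOf.

Variable n : nat.
Implicit Types (A B : {set 'I_n.+1}) (j : 'I_n.+1).

Lemma size_word_of A B : size (word_of A B) = n.+1.
Proof. by rewrite size_map size_enum_ord. Qed.

Lemma nth_word_of A B j : nth lO (word_of A B) j = (j \in A, j \in B).
Proof. by rewrite (nth_map j) ?size_enum_ord // nth_ord_enum. Qed.

Lemma eq_word_of A B s :
  size s = n.+1 -> (forall j, nth lO s j = (j \in A, j \in B)) ->
  s = word_of A B.
Proof.
move=> szs nths; apply: (@eq_from_nth _ lO); rewrite ?size_word_of // szs => k
  ltk.
by rewrite (nths (Ordinal ltk)) -nth_word_of.
Qed.

Lemma swap_word_of A B : swap_word (word_of A B) = word_of B A.
Proof. by rewrite /swap_word /word_of -map_comp. Qed.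

Lemma add1_word_of A B j : add1 j (word_of A B) = word_of (j |: A) B.
Proof.
apply: eq_word_of => [|k]; first by rewrite size_set_nth size_word_of;
  apply/maxn_idPr.
rewrite nth_set_nth /= !nth_word_of in_setU1.
by case: (k =P j :> nat) => [/val_inj -> | /eqP ne];
  rewrite ?eqxx // -val_eqE (negPf ne).
Qed.

Lemma add2_word_of A B j : add2 j (word_of A B) = word_of A (j |: B).
Proof.
apply: eq_word_of => [|k]; first by rewrite size_set_nth size_word_of;
  apply/maxn_idPr.
rewrite nth_set_nth /= !nth_word_of in_setU1.
by case: (k =P j :> nat) => [/val_inj -> | /eqP ne];
  rewrite ?eqxx // -val_eqE (negPf ne).
Qed.

Lemma has_fst_word_of A B : has (fun l => l.1) (word_of A B) = (A != set0).
Proof.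
rewrite /word_of has_map; apply/hasP/set0Pn => [[j _ Aj]|[j Aj]];
  exists j => //.
by rewrite mem_enum.
Qed.

Lemma has_snd_word_of A B : has (fun l => l.2) (word_of A B) = (B != set0).
Proof.
rewrite /word_of has_map; apply/hasP/set0Pn => [[j _ Aj]|[j Aj]];
  exists j => //.
by rewrite mem_enum.
Qed.

End WordOf.

Lemma del_word_of n (A B : {set 'I_n.+1}) (j : 'I_n.+2) :
  del j (word_of (lift j @: A) (lift j @: B)) = word_of A B.
Proof.
have lej : (j <= n.+1)%N by rewrite -ltnS.
have szt : size (take j (word_of (lift j @: A) (lift j @: B))) = j.
  by rewrite size_takel // size_word_of ltnW.
apply: eq_word_of => [|k].
  by rewrite size_cat szt size_drop size_word_of; lia.
rewrite /del nth_cat szt -!(mem_imset _ _ (@lift_inj _ j)) -nth_word_of /=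
  /bump.
case: ltnP => [ltkj|lejk]; first by rewrite nth_take.
by rewrite nth_drop; congr nth; lia.
Qed.

(** * Faces of a simplex as vertex sets *)

Section Vset.

Variables p n : nat.
Implicit Types (y : injMap p n) (A : {set 'I_n.+1}).

Lemma injMap_lt y (i j : 'I_p.+1) : (i < j)%N -> (val y i < val y j)%N.
Proof. exact: (implyP (forallP (forallP (valP y) i) j)). Qed.

Lemma injMap_inj y : injective (val y).
Proof.
move=> i j eq_y; case: (ltngtP i j) => [/(injMap_lt y)|/(injMap_lt y)|/val_inj
  //].
- by rewrite eq_y ltnn.
- by rewrite eq_y ltnn.
Qed.

Lemma card_vset y : #|vset y| = p.+1.
Proof. by rewrite card_imset ?card_ord //; apply: injMap_inj. Qed.

(** The values of a face in order form a strictly sorted list, which is determined by its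
    members. *)
Lemma vset_inj : injective (@vset p n).
Proof.
move=> y y' eqv; apply: val_inj; apply/ffunP => i.
pose s (z : injMap p n) := [seq val (val z j) | j <- enum 'I_p.+1].
have sorted_s z : sorted ltn (s z).
  have := iota_ltn_sorted 0 p.+1; rewrite -val_enum_ord !sorted_map.
  by apply: sub_sorted => j k; apply: injMap_lt.
have mem_s z k : (k \in s z) = (k \in [seq val j | j <- enum (vset z)]).
  apply/mapP/mapP => -[j + ->].
    by move=> _; exists (val z j) => //; rewrite mem_enum imset_f.
  by rewrite mem_enum => /imsetP[i' _ ->]; exists i'; rewrite ?mem_enum.
have eq_s : s y = s y'.
  apply: (irr_sorted_eq ltn_trans ltnn) => // k.
  by rewrite !mem_s eqv.
have nth_s z : nth 0%N (s z) i = val z i.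
  by rewrite (nth_map i) ?size_enum_ord // nth_ord_enum.
by apply: val_inj; rewrite /= -!nth_s eq_s.
Qed.

Lemma ex_vset A : #|A| = p.+1 -> exists y, vset y = A.
Proof.
move=> cA; have szA : size (enum A) = p.+1 by rewrite -cardE.
pose f := [ffun i : 'I_p.+1 => nth ord0 (enum A) i].
have sA : sorted (relpre val ltn) (enum A).
  rewrite -sorted_map; rewrite {1}/enum_mem -enumT.
  (* Membership in [A] is moved to natural numbers, so that the list is a filter of the sorted list
     [iota 0 n.+1]. *)
  have -> : [seq val i | i <- enum 'I_n.+1 & mem A i] =
     [seq k <- [seq val i | i <- enum 'I_n.+1] | (k < n.+1)%N && (inord k \in
       A)].
    rewrite filter_map; congr map; apply: eq_filter => i /=.
    by rewrite ltn_ord inord_val.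
  by apply: sorted_filter; [apply: ltn_trans | rewrite val_enum_ord
    iota_ltn_sorted].
have mf : strict_mono f.
  apply/forallP => i; apply/forallP => j; apply/implyP => ltij; rewrite !ffunE.
  apply: (@sorted_ltn_nth _ (relpre val ltn)) => //; rewrite ?inE ?szA //.
  by move=> ? ? ?; apply: ltn_trans.
exists (Sub f mf : injMap p n); apply/setP => k;
  apply/imsetP/idP => [[i _ ->]|kA].
  by rewrite SubK ffunE -mem_enum mem_nth ?szA.
have ltk : (index k (enum A) < p.+1)%N by rewrite -szA index_mem mem_enum.
by exists (Ordinal ltk); rewrite // SubK ffunE nth_index ?mem_enum.
Qed.

End Vset.

Lemma vset_comp k m n (g : injMap m n) (f : injMap k m) :
  vset (comp_inj g f) = val g @: vset f.
Proof. by rewrite /vset -imset_comp; apply: eq_imset => i;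
  rewrite /= ffunE. Qed.

Lemma vset_coface n (j : 'I_n.+2) : vset (coface j) = [set~ j].
Proof.
apply/setP => k; rewrite !inE; apply/imsetP/idP => [[i _ ->]|].
  by rewrite ffunE eq_sym neq_lift.
by rewrite eq_sym => /unlift_some[i -> _]; exists i; rewrite // ffunE.
Qed.

Lemma vset_comp_coface p n (y : injMap p.+1 n) j :
  vset (comp_inj y (coface j)) = vset y :\ val y j.
Proof.
rewrite vset_comp vset_coface; apply/setP => k; rewrite !inE.
apply/imsetP/andP => [[i + ->]|[+ /imsetP[i _ ek]]].
  by rewrite !inE (inj_eq (@injMap_inj _ _ y)) imset_f.
by rewrite ek (inj_eq (@injMap_inj _ _ y)) => ij; exists i; rewrite ?inE.
Qed.

(** * Cochains as functions on all vertex sets *)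

(** Extension by zero: the sum has at most one term because [vset] is injective. Sums over subsets
    can be reindexed regardless of dimension. *)
Definition set_ext p n (f : injMap p n -> 'F_2) (A : {set 'I_n.+1}) : 'F_2 :=
  \sum_(y | vset y == A) f y.

Lemma set_ext_vset p n (f : injMap p n -> 'F_2) y : set_ext f (vset y) = f y.
Proof. by rewrite /set_ext (big_pred1 y) // => z;
  rewrite (inj_eq (@vset_inj p n)). Qed.

Lemma set_ext_card p n (f : injMap p n -> 'F_2) (A : {set 'I_n.+1}) : #|A| !=
  p.+1 -> set_ext f A = 0.
Proof. by move=> cA; rewrite /set_ext big_pred0 // => y;
  apply: contraNF cA => /eqP<-; rewrite card_vset. Qed.

Lemma sum_set_ext p n (H : {set 'I_n.+1} -> 'F_2) (f : injMap p n -> 'F_2) :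
  \sum_y H (vset y) * f y = \sum_A H A * set_ext f A.
Proof.
rewrite (partition_big (@vset p n) predT) //=; apply: eq_bigr => A _.
by rewrite /set_ext mulr_sumr; apply: eq_bigr => y /eqP <-.
Qed.

Lemma set_ext_face p n (f : injMap p n -> 'F_2) (A : {set 'I_n.+1}) :
  set_ext (fun y : injMap p.+1 n => \sum_j f (comp_inj y (coface j))) A =
  \sum_(v in A) set_ext f (A :\ v).
Proof.
have [cA|cA] := eqVneq #|A| p.+2; last first.
  rewrite set_ext_card // big1 // => v vA; rewrite set_ext_card //.
  by apply: contra cA => /eqP cA; rewrite (cardsD1 v A) vA cA.
have [y <-] := ex_vset cA; rewrite set_ext_vset (big_imset _ (in2W (@injMap_inj
  _ _ y))) /=.
by apply: eq_bigr => j _; rewrite -vset_comp_coface set_ext_vset.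
Qed.

Lemma set_ext_comp_coface p n (f : injMap p n.+1 -> 'F_2) j
    (A : {set 'I_n.+1}) :
  set_ext (fun y => f (comp_inj (coface j) y)) A = set_ext f (lift j @: A).
Proof.
have [cA|cA] := eqVneq #|A| p.+1; last first.
  by rewrite !set_ext_card // card_imset //; apply: lift_inj.
have [y <-] := ex_vset cA; rewrite set_ext_vset.
have -> : lift j @: vset y = val (coface j) @: vset y.
  by apply: eq_imset => i; rewrite ffunE.
by rewrite -vset_comp set_ext_vset.
Qed.

(** Summation by parts: removing [v] matches the pairs with [v] in [A] to those with [v] outside. It
    moves a coboundary from a cochain onto the coefficients. *)
Lemma sum_face_shift n (H F : {set 'I_n} -> 'F_2) :
  \sum_(A : {set 'I_n}) H A * (\sum_(v in A) F (A :\ v)) =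
  \sum_(A : {set 'I_n}) (\sum_(v in ~: A) H (v |: A)) * F A.
Proof.
under eq_bigr do rewrite mulr_sumr.
under [RHS]eq_bigr do rewrite mulr_suml.
rewrite (exchange_big_dep predT) //= [RHS](exchange_big_dep predT) //=.
apply: eq_bigr => v _.
rewrite (reindex_onto (fun A => v |: A) (fun A => A :\ v)) /=; last first.
  by move=> A vA; rewrite setD1K.
apply: eq_big => A.
  by rewrite setU11 /= inE; apply/eqP/idP => [<-|vA]; rewrite ?setD11 ?setU1K.
by case/andP => _ /eqP ->.
Qed.

(** The map [lift j] identifies the vertex sets of the facet opposite [j] with the sets that avoid
    [j]. *)
Lemma sum_lift n (j : 'I_n.+2) (H : {set 'I_n.+1} -> {set 'I_n.+1} -> 'F_2)
    (K : {set 'I_n.+2} -> {set 'I_n.+2} -> 'F_2) :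
  (forall A B : {set 'I_n.+1}, K (lift j @: A) (lift j @: B) = H A B) ->
  forall F G : {set 'I_n.+2} -> 'F_2,
  \sum_(A : {set 'I_n.+1}) \sum_(B : {set 'I_n.+1}) H A B * (F (lift j @: A) *
    G (lift j @: B)) =
  \sum_(A : {set 'I_n.+2}) \sum_(B : {set 'I_n.+2}) ((j \notin A) && (j \notin
    B))%:R * K A B * (F A * G B).
Proof.
move=> HK F G.
have liftK (A : {set 'I_n.+1}) : lift j @^-1: (lift j @: A) = A.
  by apply/setP => i; rewrite inE mem_imset //; apply: lift_inj.
have liftN (A : {set 'I_n.+1}) : j \notin lift j @: A.
  by apply/imsetP => -[i _] /eqP; rewrite (negPf (neq_lift _ _)).
have Klift (A : {set 'I_n.+2}) : j \notin A -> lift j @: (lift j @^-1: A) = A.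
  move=> jA; apply/setP => i; apply/imsetP/idP => [[k]|iA];
    first by rewrite inE => ? ->.
  have /unlift_some[k ek _] : j != i by apply: contraNneq jA => ->.
  by exists k; rewrite // inE -ek.
have red (E : {set 'I_n.+2} -> 'F_2) :
    (forall A : {set 'I_n.+2}, j \in A -> E A = 0) ->
    \sum_A E A = \sum_(A : {set 'I_n.+1}) E (lift j @: A).
  move=> E0; rewrite (bigID (fun A : {set 'I_n.+2} => j \in A)) /= big1 //
    add0r.
  rewrite (reindex_onto (fun A : {set 'I_n.+1} => lift j @: A)
             (fun A => lift j @^-1: A)) //=.
  by apply: eq_bigl => A; rewrite liftN liftK eqxx.
rewrite [RHS]red => [|A jA]; last by rewrite big1 // => B _; rewrite jA !mul0r.
apply: eq_bigr => A _; rewrite [RHS]red => [|B jB];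
  last by rewrite jB andbF !mul0r.
by apply: eq_bigr => B _; rewrite !liftN HK mul1r.
Qed.

(** * From coefficients on words to semi-simplicial constructions *)

(** Paired with two cochains, the three sums become the coboundary of the first factor, of the
    second factor, and of the product. *)
Lemma wdiff_word_of f n (A B : {set 'I_n.+1}) :
  wdiff f (word_of A B) =
    \sum_(v in ~: A) f (word_of (v |: A) B)
  + \sum_(v in ~: B) f (word_of A (v |: B))
  + \sum_v ((v \notin A) && (v \notin B))%:R * f (del v (word_of A B)).
Proof.
rewrite /wdiff size_word_of big_mkord [X in X + _ + _]big_mkcond.
rewrite [X in _ + X + _]big_mkcond -!big_split; apply: eq_bigr => v _.
rewrite /wdiff_at nth_word_of add1_word_of add2_word_of !inE xpair_eqE
  !eqbF_neg /=.
by case: (v \in A); case: (v \in B) => /=; ring.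
Qed.

(* The coefficient of [y (x) z] in [triangle_i] depends on the word whose
   letters record the membership of each vertex in [y] and [z]. *)
Definition coproducts_of (c : nat -> seq letter -> 'F_2) : coproducts :=
  fun i n p q y z => (p + q == n + i)%N%:R * c i (word_of (vset y) (vset z)).

(* The empty set is not a simplex, so words with an empty side are ignored. *)
Definition coherent (c : nat -> seq letter -> 'F_2) :=
  forall i s, has (fun l => l.1) s -> has (fun l => l.2) s ->
  wdiff (c i) s = if i is j.+1 then c j s + c j (swap_word s) else 0.

Section CupOf.

Variables (c : nat -> seq letter -> 'F_2) (X : ssSet).

Local Notation cupc := (cup_of (coproducts_of c)).

Local Notation ext a x := (set_ext (fun y => a (act X y x) : 'F_2)).

Lemma sum_coproducts_of i n p q (f : injMap p n -> 'F_2) (g : injMap q n ->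
  'F_2) :
  \sum_y \sum_z coproducts_of c i y z * (f y * g z) =
  (p + q == n + i)%N%:R *
    \sum_A \sum_B c i (word_of A B) * (set_ext f A * set_ext g B).
Proof.
rewrite /coproducts_of.
transitivity (\sum_(y : injMap p n) (\sum_(z : injMap q n)
   ((p + q == n + i)%N%:R * c i (word_of (vset y) (vset z))) * g z) * f y).
  apply: eq_bigr => y _; rewrite mulr_suml; apply: eq_bigr => z _; ring.
rewrite (sum_set_ext (fun A => \sum_(z : injMap q n)
   ((p + q == n + i)%N%:R * c i (word_of A (vset z))) * g z)).
rewrite mulr_sumr; apply: eq_bigr => A _.
rewrite (sum_set_ext (fun B => ((p + q == n + i)%N%:R * c i (word_of A B)))).
rewrite mulr_suml mulr_sumr; apply: eq_bigr => B _; ring.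
Qed.

Lemma cup_ofE i p q (a : Nvee X p) (b : Nvee X q) r (x : simp X r) :
  (cupc i a b r x : 'F_2) = (p + q == r + i)%N%:R *
    \sum_A \sum_B c i (word_of A B) * (ext a x A * ext b x B).
Proof. exact: sum_coproducts_of. Qed.

Lemma set_ext_coboundary p (a : Nvee X p) r (x : simp X r) A :
  ext (diff (Nvee X) a) x A = \sum_(v in A) ext a x (A :\ v).
Proof.
rewrite -set_ext_face; apply: eq_bigr => y _ /=.
by rewrite /coboundary; apply: eq_bigr => j _; rewrite act_comp.
Qed.

Lemma set_ext_act_coface p (a : Nvee X p) r (x : simp X r.+1) j A :
  ext a (act X (coface j) x) A = ext a x (lift j @: A).
Proof.
rewrite -set_ext_comp_coface; apply: eq_bigr => y _.
by rewrite act_comp.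
Qed.

Lemma cup_of_chain i p q r (a : Nvee X p) (b : Nvee X q) :
  coherent c ->
  diff_at (fun s => cupc i a b s) r =
  (if i is j.+1 then cupc j a b r + cupc j b a r else 0)
  + cupc i (diff (Nvee X) a) b r + cupc i a (diff (Nvee X) b) r.
Proof.
move=> coh; apply/funext => x.
pose F A := ext a x A; pose G A := ext b x A.
(* All terms of the relation carry the same degree condition, so its indicator factors out. *)
pose d := ((p + q).+1 == r + i)%N%:R : 'F_2.
have F0 : F set0 = 0 by rewrite /F set_ext_card // cards0.
have G0 : G set0 = 0 by rewrite /G set_ext_card // cards0.
pose S (H : {set 'I_r.+1} -> {set 'I_r.+1} -> 'F_2) :=
  \sum_A \sum_B H A B * (F A * G B).
have SD H K : S (fun A B => H A B + K A B) = S H + S K.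
  rewrite /S -big_split; apply: eq_bigr => A _.
  by rewrite -big_split; apply: eq_bigr => B _ /=; rewrite mulrDl.
pose D1 (A B : {set 'I_r.+1}) : 'F_2 := \sum_(v in ~: A) c i (word_of (v |: A)
  B).
pose D2 (A B : {set 'I_r.+1}) : 'F_2 := \sum_(v in ~: B) c i (word_of A (v |:
  B)).
pose D0 (A B : {set 'I_r.+1}) : 'F_2 :=
  \sum_v ((v \notin A) && (v \notin B))%:R * c i (del v (word_of A B)).
have e1 : (cupc i (diff (Nvee X) a) b r x : 'F_2) = d * S D1.
  rewrite cup_ofE addSn; congr (_ * _).
  transitivity (\sum_A (\sum_B c i (word_of A B) * G B) * ext (diff (Nvee X) a)
    x A).
    apply: eq_bigr => A _; rewrite mulr_suml; apply: eq_bigr => B _.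
    by rewrite -/(G B); ring.
  under eq_bigr do rewrite set_ext_coboundary.
  rewrite (sum_face_shift (fun A => \sum_B c i (word_of A B) * G B)).
  apply: eq_bigr => A _; rewrite exchange_big mulr_suml;
    apply: eq_bigr => B _ /=.
  by rewrite -mulr_suml -/(F A) -/(D1 A B); ring.
have e2 : (cupc i a (diff (Nvee X) b) r x : 'F_2) = d * S D2.
  rewrite cup_ofE addnS; congr (_ * _); apply: eq_bigr => A _.
  transitivity (F A * \sum_B c i (word_of A B) * ext (diff (Nvee X) b) x B).
    by rewrite mulr_sumr; apply: eq_bigr => B _; rewrite -/(F A); ring.
  under eq_bigr do rewrite set_ext_coboundary.
  rewrite sum_face_shift mulr_sumr; apply: eq_bigr => B _.
  by rewrite -/(G B) /D2; ring.
have e0 : (diff_at (fun s => cupc i a b s) r x : 'F_2) = d * S D0.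
  rewrite /d /S /D0 /F /G; clear.
  case: r x => [|r] x.
    (* On a single vertex, a vertex outside [A] forces [A] to be empty, where the extended cochain
       vanishes. *)
    rewrite [LHS]/(0 : 'F_2) big1 ?mulr0 // => A _; rewrite big1 // => B _.
    have [->|[v vA]] := set_0Vmem A; first by rewrite set_ext_card ?cards0 //
      mul0r mulr0.
    by rewrite big1 ?mul0r // => w _; rewrite (ord1 w) -(ord1 v) vA mul0r.
  rewrite /= /coboundary.
  rewrite (eq_bigr _ (fun j _ => cup_ofE i a b (act X (coface j) x))).
  rewrite addSn eqSS -mulr_sumr; congr (_ * _).
  transitivity (\sum_(j < r.+2) \sum_(A : {set 'I_r.+2}) \sum_(B : {set
    'I_r.+2})
     ((j \notin A) && (j \notin B))%:R * c i (del j (word_of A B)) * (ext a x A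
       * ext b x B)).
    apply: eq_bigr => j _.
    rewrite -(sum_lift (H := fun A B => c i (word_of A B))) => [|A B];
      last first.
      by rewrite del_word_of.
    by apply: eq_bigr => A _; apply: eq_bigr => B _;
      rewrite !set_ext_act_coface.
  rewrite exchange_big; apply: eq_bigr => A _; rewrite exchange_big.
  by apply: eq_bigr => B _; rewrite -mulr_suml.
have e3 : ((if i is j.+1 then cupc j a b r + cupc j b a r else 0) x : 'F_2) =
    d * S (fun A B => wdiff (c i) (word_of A B)).
  transitivity (d * S (fun A B =>
      if i is j.+1 then c j (word_of A B) + c j (word_of B A) else 0)).
    rewrite /d; case: (i) => [|j].
      rewrite /S big1 ?mulr0 // => A _; rewrite big1 // => B _; exact: mul0r.
    rewrite SD mulrDr addnS eqSS fctE !cup_ofE; congr (_ + _).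
    rewrite [in LHS]addnC; congr (_ * _); rewrite exchange_big.
    by apply: eq_bigr => A _; apply: eq_bigr => B _; rewrite [X in _ * X]mulrC.
  congr (_ * _); apply: eq_bigr => A _; apply: eq_bigr => B _.
  (* Coherence covers only words with two non-empty sides; at the empty set [F] and [G] vanish. *)
  have [->|nA] := eqVneq A set0; first by rewrite F0 mul0r !mulr0.
  have [->|nB] := eqVneq B set0; first by rewrite G0 !mulr0.
  by rewrite coh ?has_fst_word_of ?has_snd_word_of // swap_word_of.
rewrite !fctE in e0 e1 e2 e3 *.
rewrite e0 e1 e2 e3 -!mulrDr; congr (_ * _).
have -> : S (fun A B => wdiff (c i) (word_of A B)) = S D1 + S D2 + S D0.
  by rewrite -!SD; apply: eq_bigr => A _; apply: eq_bigr => B _;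
    rewrite wdiff_word_of.
by ring: F2_two.
Qed.

End CupOf.

Lemma family_ofE D X i p q r w (a : Nvee X p) (b : Nvee X q) (x : simp X r) :
  (@family_of D X i p q r w a b x : 'F_2) =
  (w.1 : 'F_2) * cup_of D i a b r x + (w.2 : 'F_2) * cup_of D i b a r x.
Proof. by []. Qed.

Lemma cup_of_linearl D X i p q r k (a a' : Nvee X p) (b : Nvee X q) (x : simp X
  r) :
  (cup_of D i (k *: a + a') b r x : 'F_2) =
  k * cup_of D i a b r x + cup_of D i a' b r x.
Proof.
rewrite /cup_of mulr_sumr -big_split; apply: eq_bigr => y _.
rewrite mulr_sumr -big_split; apply: eq_bigr => z _ /=.
rewrite -[(k *: a + a') _]/(k * a (act X y x) + a' (act X y x) : 'F_2).
by rewrite mulrDl mulrDr -mulrA [in LHS]mulrCA.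
Qed.

Lemma cup_of_linearr D X i p q r k (a : Nvee X p) (b b' : Nvee X q) (x : simp X
  r) :
  (cup_of D i a (k *: b + b') r x : 'F_2) =
  k * cup_of D i a b r x + cup_of D i a b' r x.
Proof.
rewrite /cup_of mulr_sumr -big_split; apply: eq_bigr => y _.
rewrite mulr_sumr -big_split; apply: eq_bigr => z _ /=.
rewrite -[(k *: b + b') _]/(k * b (act X z x) + b' (act X z x) : 'F_2).
by rewrite !mulrDr [in RHS]mulrCA; congr (_ + _); congr (_ * _); rewrite mulrCA.
Qed.

Lemma diff_at_linear X (f g : forall s, Nvee X s) (k l : 'F_2) r :
  diff_at (fun s => k *: f s + l *: g s) r = k *: diff_at f r + l *: diff_at g
    r.
Proof.
case: r => [|r] /=; first by rewrite !scaler0 addr0.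
by rewrite linearD !linearZ.
Qed.

Lemma F2_linear_aux (k u1 u2 v1 v2 f g : 'F_2) :
  (k * u1 + v1) * f + (k * u2 + v2) * g =
  k * (u1 * f + u2 * g) + (v1 * f + v2 * g).
Proof. by ring. Qed.

Lemma F2_linear_aux2 (k u1 u2 f f' g g' : 'F_2) :
  u1 * (k * f + f') + u2 * (k * g + g') =
  k * (u1 * f + u2 * g) + (u1 * f' + u2 * g').
Proof. by ring. Qed.

Lemma ss_construction_of c :
  coherent c -> ss_construction (family_of (coproducts_of c)).
Proof.
move=> coh; split=> [X|X Y f i p q r w a b]; last first.
  apply/funext => x; rewrite /pull !family_ofE /cup_of.
  by congr (_ * _ + _ * _); apply: eq_bigr => y _; apply: eq_bigr => z _;
     rewrite !smap_act.
split.
- move=> i p q r a b k u v; apply/funext => x.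
  exact: (F2_linear_aux k u.1 u.2 v.1 v.2).
- move=> i p q r w b k a a'; apply/funext => x; rewrite family_ofE.
  rewrite cup_of_linearl cup_of_linearr; exact: F2_linear_aux2.
- move=> i p q r w a k b b'; apply/funext => x; rewrite family_ofE.
  rewrite cup_of_linearl cup_of_linearr; exact: F2_linear_aux2.
- move=> i p q r w a b pq; apply/funext => x; rewrite family_ofE !cup_ofE.
  by rewrite [(q + p)%N]addnC (negPf pq) !mul0r !mulr0 addr0.
- by move=> i p q r w a b; apply/funext => x; rewrite !family_ofE addrC.
move=> i p q r w a b; rewrite diff_at_linear !cup_of_chain // /family_of.
set A1 := cup_of _ i (diff _ a) b r; set B1 := cup_of _ i a (diff _ b) r.
set A2 := cup_of _ i (diff _ b) a r; set B2 := cup_of _ i b (diff _ a) r.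
(* Transposition exchanges the two coboundary terms, so [a1] is grouped with [b2] and [b1] with
   [a2]. *)
have aux (V : lmodType 'F_2) (w1 w2 : 'F_2) (z1 z2 a1 b1 a2 b2 : V) :
    w1 *: (z1 + a1 + b1) + w2 *: (z2 + a2 + b2) =
    (w1 *: z1 + w2 *: z2) + (w1 *: a1 + w2 *: b2) + (w1 *: b1 + w2 *: a2).
  rewrite !scalerDr addrACA [X in X + _]addrACA -!(addrA (_ + _));
    congr (_ + _).
  by rewrite [w1 *: b1 + w2 *: b2]addrC addrACA [w2 *: a2 + w1 *: b1]addrC.
rewrite aux; congr (_ + _ + _).
case: i w {A1 B1 A2 B2} => [|i] w; first by rewrite !scaler0 addr0.
rewrite -[(Wdiff w).1]/(w.1 + w.2) -[(Wdiff w).2]/(w.2 + w.1).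
set C1 := cup_of _ i a b r; set C2 := cup_of _ i b a r.
rewrite !scalerDr !scalerDl [w.2 *: C2 + w.2 *: C1]addrC addrACA.
by rewrite [w.1 *: C2 + w.2 *: C2]addrC.
Qed.

(** * Naturality with respect to codegeneracies *)

Lemma add1_cat s1 l s2 : add1 (size s1) (s1 ++ l :: s2) = s1 ++ (true, l.2) ::
  s2.
Proof. by elim: s1 => //= x s1 <-. Qed.

Lemma add2_cat s1 l s2 : add2 (size s1) (s1 ++ l :: s2) = s1 ++ (l.1, true) ::
  s2.
Proof. by elim: s1 => //= x s1 <-. Qed.

Lemma sum_setU1 n (v : 'I_n) (H : {set 'I_n} -> 'F_2) :
  \sum_A H A = \sum_(A : {set 'I_n}) (v \notin A)%:R * (H A + H (v |: A)).
Proof.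
rewrite (bigID (fun A : {set 'I_n} => v \in A)) /= [RHS](bigID (fun A : {set
  'I_n} => v \in A)) /=.
rewrite [X in _ = X + _]big1 ?add0r => [|A -> /=]; last by rewrite mul0r.
rewrite [X in X + _](reindex_onto (fun A => v |: A) (fun A => A :\ v)) /=;
  last first.
  by move=> A vA; rewrite setD1K.
rewrite addrC [X in _ + X](eq_bigl (fun A : {set 'I_n} => v \notin A)) => [|A].
  by rewrite -big_split; apply: eq_bigr => A ->; rewrite mul1r.
rewrite setU11 /=; apply/eqP/idP => [<-|vA]; rewrite ?setD11 ?setU1K //.
Qed.

(** Subsets are grouped in fours by their trace on [u] and [v]. *)
Lemma sum_setU2 n (u v : 'I_n) (H F : {set 'I_n} -> 'F_2) :
  u != v ->
  (forall A : {set 'I_n}, u \in A -> v \in A -> F A = 0) ->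
  (forall A : {set 'I_n}, u \notin A -> v \notin A -> F (v |: A) = F (u |: A))
    ->
  \sum_A H A * F A = \sum_(A : {set 'I_n}) ((u \notin A) && (v \notin A))%:R *
    (H A * F A + (H (u |: A) + H (v |: A)) * F (u |: A)).
Proof.
move=> neq F0 Feq; rewrite (sum_setU1 v) (sum_setU1 u); apply: eq_bigr => A _.
rewrite !inE [v == u]eq_sym (negPf neq) /=.
have [uA|uA] /= := boolP (u \in A); first by rewrite !mul0r.
have [vA|vA] /= := boolP (v \in A); first by rewrite !mul0r addr0 mulr0.
rewrite Feq // [F (v |: _)]F0 ?inE ?eqxx ?orbT //; ring.
Qed.

Section Degenerate.

Variables (r k : nat) (ltk : (k.+1 < r.+1)%N) (f : seq letter -> 'F_2).
Hypothesis df : degen_compat f.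

Let u : 'I_r.+1 := Ordinal (ltnW ltk).
Let v : 'I_r.+1 := Ordinal ltk.

(** Satisfied by pullbacks along a map that identifies [u] and [v], with degenerate images sent to
    0. *)
Definition collapse_invariant (F : {set 'I_r.+1} -> 'F_2) :=
  (forall A : {set 'I_r.+1}, u \in A -> v \in A -> F A = 0) /\
  (forall A : {set 'I_r.+1}, u \notin A -> v \notin A -> F (v |: A) = F (u |:
    A)).

(** Grouping [A] and [B] by their traces on [u] and [v] leaves one collapse of [f] for each of the
    four letters. *)
Lemma sum_degenerate F G :
  collapse_invariant F -> collapse_invariant G ->
  \sum_A \sum_B f (word_of A B) * (F A * G B) = 0.
Proof.
move=> [F0 Feq] [G0 Geq].
have uv : u != v by rewrite -val_eqE /= neq_ltn ltnSn.
have word_split (A B : {set 'I_r.+1}) : u \notin A -> v \notin A -> u \notin B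
  -> v \notin B ->
    exists s1 s2, [/\ size s1 = k & word_of A B = s1 ++ [:: lO, lO & s2]].
  move=> uA vA uB vB; pose s := word_of A B.
  exists (take k s), (drop k.+2 s); split; first by rewrite size_takel //
    size_word_of; lia.
  rewrite -[LHS](cat_take_drop k) -/s; congr (_ ++ _).
  rewrite (drop_nth lO) ?size_word_of; last by lia.
  rewrite (drop_nth lO) ?size_word_of //.
  by rewrite (nth_word_of A B u) (nth_word_of A B v) (negPf uA) (negPf vA)
    (negPf uB) (negPf vB).
have add1v s1 l l' s2 : size s1 = k -> add1 v (s1 ++ [:: l, l' & s2]) = s1 ++
  [:: l, (true, l'.2) & s2].
  by move=> sz; rewrite -!(cat_rcons l) -add1_cat size_rcons sz.
have add2v s1 l l' s2 : size s1 = k -> add2 v (s1 ++ [:: l, l' & s2]) = s1 ++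
  [:: l, (l'.1, true) & s2].
  by move=> sz; rewrite -!(cat_rcons l) -add2_cat size_rcons sz.
have add1u s1 l s2 : size s1 = k -> add1 u (s1 ++ l :: s2) = s1 ++ (true, l.2)
  :: s2.
  by move=> sz; rewrite -add1_cat sz.
have add2u s1 l s2 : size s1 = k -> add2 u (s1 ++ l :: s2) = s1 ++ (l.1, true)
  :: s2.
  by move=> sz; rewrite -add2_cat sz.
transitivity (\sum_A (\sum_B f (word_of A B) * G B) * F A).
  apply: eq_bigr => A _; rewrite mulr_suml; apply: eq_bigr => B _; ring.
rewrite (sum_setU2 _ uv F0 Feq) big1 // => A _.
have [/andP[uA vA]|_] := boolP (_ && _); last by rewrite mul0r.
rewrite -big_split /=.
under [X in _ * (_ + X * _)]eq_bigr do rewrite -mulrDl.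
rewrite !(sum_setU2 _ uv G0 Geq) !big1 ?mul0r ?addr0 ?mulr0 // => B _.
all: have [/andP[uB vB]|_] := boolP (_ && _); last by rewrite mul0r.
all: have [s1 [s2 [sz ew]]] := word_split A B uA vA uB vB.
all: rewrite -?add1_word_of -?add2_word_of ew ?(add1u, add1v, add2u, add2v) //=.
(* Here [A] is enlarged by [u] or [v], so the collapsed letter is L or B; in the other case it is O
   or R. *)
- have := df s1 lB s2; have := df s1 lL s2 => /= eL eB.
  rewrite eL mul0r add0r; apply: etrans (_ : 0 * G (u |: B) = 0);
    last by rewrite mul0r.
  by rewrite -eB; ring.
have := df s1 lO s2; have := df s1 lR s2 => /= eR eO.
by rewrite eR eO !mul0r addr0 mulr0.
Qed.

End Degenerate.

(** The indicator says that [g] is injective on [A]; otherwise the image is degenerate and the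
    pullback is 0. *)
Lemma set_ext_pull_mono r m n (f : monoMap m n) (x : injMap r m) p
    (a : Nvee (Delta n) p) (A : {set 'I_r.+1}) :
  let g i := val f (val x i) in
  set_ext (fun u => pull_mono f a (comp_inj x u) : 'F_2) A =
  (#|g @: A| == #|A|)%:R * set_ext a (g @: A).
Proof.
move=> g; have [cA|cA] := eqVneq #|A| p.+1; last first.
  rewrite set_ext_card //; case: eqP => [e|_]; last by rewrite mul0r.
  by rewrite set_ext_card ?mulr0 // e.
have [y yA] := ex_vset cA; rewrite -yA set_ext_vset /pull_mono.
case: insubP => [t _ et|nmono].
  have et' i : val t i = g (val y i) by rewrite et !ffunE.
  have -> : g @: vset y = vset t.
    by rewrite /vset -imset_comp; apply: eq_imset => i; rewrite et'.
  by rewrite !card_vset eqxx mul1r set_ext_vset.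
case: eqP => [/eqP /imset_injP ginj|_]; last by rewrite mul0r.
case/negP: nmono; apply/forallP => i; apply/forallP => j; apply/implyP => ltij.
rewrite !ffunE ltn_neqAle; apply/andP; split; last first.
  apply: (implyP (forallP (forallP (valP f) _) _)).
  by apply: ltnW; apply: injMap_lt; apply: injMap_lt.
apply/negP => /eqP /val_inj /ginj eij.
have /(injMap_inj (y := y)) e : val y i = val y j by apply: eij;
  rewrite imset_f.
by rewrite e ltnn in ltij.
Qed.

(** If [f] is injective on the simplex [x], both sides are computed on the image face. Otherwise the
    left side is 0, and the right side is 0 by [sum_degenerate]. *)
Lemma is_simplicial_of c :
  (forall i, degen_compat (c i)) -> is_simplicial (family_of (coproducts_of c)).
Proof.
move=> dc m n f i p q r w a b; apply/funext => x;
  rewrite family_ofE {1}/pull_mono.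
case: insubP => [y _ ey|nmono].
  have pullE s (e : Nvee (Delta n) s) (u : injMap s r) :
      pull_mono f e (comp_inj x u) = e (comp_inj y u).
    rewrite /pull_mono; case: insubP => [t _ et|]; last first.
      case/negP; rewrite -[X in strict_mono X](_ : val (comp_inj y u) = _)
        ?valP //.
      by apply/ffunP => j; rewrite !ffunE ey !ffunE.
    congr e; apply: val_inj; apply/ffunP => j; rewrite et !ffunE ey !ffunE //.
  rewrite family_ofE /cup_of.
  by congr (_ * _ + _ * _); apply: eq_bigr => u _; apply: eq_bigr => v _;
     rewrite /= !pullE.
pose g (i : 'I_r.+1) := val f (val x i).
have g_le (j j' : 'I_r.+1) : (j <= j')%N -> (g j <= g j')%N.
  move=> lejj; apply: (implyP (forallP (forallP (valP f) _) _)).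
  by case: ltngtP lejj => // [/(injMap_lt x)/ltnW //|/val_inj ->].
(* A weakly increasing map that is not strictly increasing agrees on two consecutive vertices. *)
have [k [ltk gk]] : exists k (ltk : (k.+1 < r.+1)%N),
    g (Ordinal (ltnW ltk)) = g (Ordinal ltk).
  apply: contrapT => nk; case/negP: nmono.
  apply/forallP => j; apply/forallP => j'; rewrite !ffunE -/(g j) -/(g j').
  apply/implyP; case: j' => j' ltj' /= ltj.
  elim: j' ltj' ltj => // j' IH ltj'.
  have lt' : (g (Ordinal (ltnW ltj')) < g (Ordinal ltj'))%N.
    rewrite ltn_neqAle g_le ?leqnSn // andbT; apply/negP => /eqP /val_inj e.
    by apply: nk; exists j', ltj'.
  rewrite ltnS leq_eqVlt => /orP[/eqP ej|/(IH (ltnW ltj')) ltg].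
    by move: lt'; congr (g _ < _)%N; apply: val_inj.
  exact: ltn_trans ltg lt'.
have inv s (e : Nvee (Delta n) s) :
    collapse_invariant ltk (set_ext (fun u => pull_mono f e (comp_inj x u) :
      'F_2)).
  have neq : Ordinal (ltnW ltk) != Ordinal ltk by rewrite -val_eqE /= neq_ltn
    ltnSn.
  split=> A uA vA; rewrite !set_ext_pull_mono -/g.
    case: eqP => [/eqP /imset_injP ginj|_]; last by rewrite mul0r.
    by case/eqP: neq; apply: ginj.
  by rewrite !imsetU1 gk !cardsU1 uA vA.
symmetry; apply: add_eq0.
  by rewrite /cup_of sum_coproducts_of (sum_degenerate (dc i) (inv _ _) (inv _
    _)) !mulr0.
by rewrite /cup_of sum_coproducts_of (sum_degenerate (dc i) (inv _ _) (inv _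
  _)) !mulr0.
Qed.

(** * Values on dual basis elements and criteria for the axioms *)

Lemma comp_injI k m n (g : injMap m n) : injective (fun f : injMap k m =>
  comp_inj g f).
Proof.
move=> f f' /(congr1 val) /= /ffunP ef; apply: val_inj; apply/ffunP => i.
by have := ef i; rewrite !ffunE => /injMap_inj.
Qed.

Lemma comp_id_inj k n (f : injMap k n) : comp_inj (id_inj n) f = f.
Proof. by apply: val_inj; apply/ffunP => i; rewrite !ffunE. Qed.

Section DualBasis.

Variables (D : coproducts) (n i p q r : nat) (x : injMap r n).

Lemma cup_of_dual (y : injMap p r) (z : injMap q r) :
  (@cup_of D (Delta n) i p q (dual_basis (comp_inj x y)) (dual_basis (comp_inj
    x z)) r x
     : 'F_2) = @D i r p q y z.
Proof.
rewrite /cup_of (bigD1 y) //= [X in _ + X]big1 ?addr0 => [|y' ny]; last first.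
  by apply: big1 => z' _; rewrite /dual_basis !(inj_eq (@comp_injI _ _ _ x))
    (negPf ny) mul0r mulr0.
rewrite (bigD1 z) //= [X in _ + X]big1 ?addr0 => [|z' nz]; last first.
  by rewrite /dual_basis !(inj_eq (@comp_injI _ _ _ x)) (negPf nz) !mulr0.
by rewrite /dual_basis !eqxx !mulr1.
Qed.

Lemma cup_of_dual_neq0 (y : injMap p n) (z : injMap q n) :
  (@cup_of D (Delta n) i p q (dual_basis y) (dual_basis z) r x : 'F_2) != 0 ->
  exists y' z', [/\ y = comp_inj x y', z = comp_inj x z' & @D i r p q y' z' !=
    0].
Proof.
move=> nz.
have /existsP[y' /existsP[z' /andP[/eqP ey /eqP ez]]] :
    [exists y', exists z', (comp_inj x y' == y) && (comp_inj x z' == z)].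
  apply: contraNT nz; rewrite negb_exists => /forallP ny.
  apply/eqP; rewrite /cup_of big1 // => y' _; rewrite big1 // => z' _.
  have := ny y'; rewrite negb_exists => /forallP /(_ z');
    rewrite /dual_basis /=.
  by case: eqP => //=; case: eqP => //= _ _ _; rewrite ?mul0r ?mulr0.
by exists y', z'; rewrite -ey -ez; split=> //; rewrite -cup_of_dual ey ez.
Qed.

End DualBasis.

Lemma cup_family_of D X i p q r (a : Nvee X p) (b : Nvee X q) :
  cup (@family_of D X) i a b r = cup_of D i a b r.
Proof.
apply/funext => x; rewrite /cup family_ofE /F2S2_one /=.
by rewrite mul1r mul0r addr0.
Qed.

Lemma family_of_id D n i p q w (y : injMap p n) (z : injMap q n) :
  (@family_of D (Delta n) i p q n w (dual_basis y) (dual_basis z) (id_inj n) :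
    'F_2) =
  (w.1 : 'F_2) * D i n p q y z + (w.2 : 'F_2) * D i n q p z y.
Proof.
have := cup_of_dual D i (id_inj n) y z; have := cup_of_dual D i (id_inj n) z y.
by rewrite family_ofE !comp_id_inj => -> ->.
Qed.

Lemma coproducts_of_neq0 c i n p q (y : injMap p n) (z : injMap q n) :
  coproducts_of c i y z != 0 -> c i (word_of (vset y) (vset z)) != 0.
Proof. by apply: contra => /eqP e; rewrite /coproducts_of e mulr0. Qed.

(** A vertex of [x] outside [y] lies in neither [y1] nor [y2] and puts an O into their word in
    [x]. *)
Lemma is_irreducible_of c :
  (forall i s, lO \in s -> c i s = 0) -> is_irreducible (family_of
    (coproducts_of c)).
Proof.
move=> cO i n k l p q x y y1 y2 /properP[_ [v vx vy]] y1y y2y;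
  rewrite cup_family_of.
apply/eqP/negPn/negP => /cup_of_dual_neq0[u1 [u2 [e1 e2 /coproducts_of_neq0
  /negP[]]]].
apply/eqP/cO; case/imsetP: vx vy => j _ -> vy.
have /andP[j1 j2] : (j \notin vset u1) && (j \notin vset u2).
  apply/andP; split; apply: contra vy => ju.
    by apply: (subsetP y1y); rewrite e1 vset_comp imset_f.
  by apply: (subsetP y2y); rewrite e2 vset_comp imset_f.
by apply/mapP; exists j; rewrite ?mem_enum // (negPf j1) (negPf j2).
Qed.

(** A symmetric nonzero product has the word of [i + 1] letters B: both factors are the whole
    i-simplex, the case that the axiom excepts. *)
Lemma is_free_of c :
  (forall i s, c i s != 0 -> c i (swap_word s) != 0 -> s = nseq i.+1 lB) ->
  is_free (family_of (coproducts_of c)).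
Proof.
move=> cB i n p q x x' pq sym r; apply/funext => w; apply/eqP/negPn/negP => nz.
have nz' : cup (family_of (coproducts_of c) (X := Delta n)) i (dual_basis x')
  (dual_basis x) r w != 0.
  by rewrite -sym.
move: nz nz'; rewrite !cup_family_of.
move=> /cup_of_dual_neq0[y [z [-> -> nD]]]; rewrite cup_of_dual => nD'.
have := coproducts_of_neq0 nD'; rewrite -swap_word_of.
move/(cB _ _ (coproducts_of_neq0 nD)) => ew.
have er : r = i by have := congr1 size ew; rewrite size_word_of size_nseq =>
  -[].
have full (j : 'I_r.+1) : (j \in vset y, j \in vset z) = lB.
  by rewrite -nth_word_of ew nth_nseq -er ltn_ord.
have ep : p = r.
  have /eqP := card_vset y; rewrite (_ : vset y = setT) ?cardsT ?card_ord =>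
    [/eqP[]//|].
  by apply/setP => j; rewrite inE; case: (full j).
have eq : q = r.
  have /eqP := card_vset z; rewrite (_ : vset z = setT) ?cardsT ?card_ord =>
    [/eqP[]//|].
  by apply/setP => j; rewrite inE; case: (full j).
by case: pq; rewrite ?ep ?eq er.
Qed.

(** * Comparison with the canonical construction *)

(** The two parity parts of [U] are disjoint, so no vertex is missing from both faces. *)
Lemma canonical_coproducts_cover i n p q (y : injMap p n) (z : injMap q n) j :
  j \notin vset y -> j \notin vset z -> canonical_coproducts i y z = 0.
Proof.
move=> jy jz; apply: big1 => U _; case: eqP => //= ey; case: eqP => //= ez.
by move: jy jz; rewrite ey ez !inE !negbK => /andP[_ /eqP ->]; rewrite andbF.
Qed.

Lemma vset_id n : vset (id_inj n) = setT.
Proof. by apply/setP => j; rewrite inE; apply/imsetP; exists j;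
  rewrite ?ffunE. Qed.

Lemma canonical_coproducts_vertex : canonical_coproducts 0 (id_inj 0) (id_inj
  0) = 1.
Proof.
have part0 e : parity_part (set0 : {set 'I_1}) e = set0.
  by apply/setP => j; rewrite !inE.
rewrite /canonical_coproducts (big_pred1 set0) => [|U];
  last by rewrite addn0 cards_eq0.
by rewrite !part0 setC0 vset_id eqxx.
Qed.

(** On a point, both coefficients of any [phi 0 F2S2_one] multiply the same value 0, while the
    canonical product of the vertex with itself is 1. *)
Lemma not_isomorphic_vertex c :
  c 0%N [:: lB] = 0 -> ~ isomorphic (family_of (coproducts_of c)) canonical.
Proof.
move=> c0 [phi _ /(_ (Delta 0) 0%N 0%N 0%N 0%N F2S2_one
  (dual_basis (id_inj 0)) (dual_basis (id_inj 0))) /(congr1 (fun f => f (id_inj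
    0)))].
rewrite /canonical !family_of_id canonical_coproducts_vertex /coproducts_of.
rewrite (_ : word_of _ _ = [:: lB]) => [|]; last first.
  by rewrite /word_of vset_id enum_ordSl; case: (enum 'I_0) => [|[]] //=;
    rewrite !inE.
by rewrite c0 !mulr0 mul0r !addr0 mul1r => /eqP; rewrite eq_sym oner_eq0.
Qed.

Lemma word_of_nat n (a b : pred nat) :
  word_of [set j : 'I_n.+1 | a j] [set j : 'I_n.+1 | b j] =
  [seq (a k, b k) | k <- iota 0 n.+1].
Proof. by rewrite -val_enum_ord -map_comp; apply: eq_map => j;
  rewrite /= !inE. Qed.

Lemma vset_coface0 n : vset (coface (ord0 : 'I_n.+2)) = [set j : 'I_n.+2 | (0 <
  j)%N].
Proof. by rewrite vset_coface; apply/setP => j; rewrite !inE -lt0n. Qed.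

Lemma vset_coface00 n :
  vset (comp_inj (coface (ord0 : 'I_n.+3)) (coface (ord0 : 'I_n.+2))) =
  [set j : 'I_n.+3 | (1 < j)%N].
Proof.
rewrite vset_comp vset_coface0; apply/setP => j; rewrite inE.
apply/imsetP/idP => [[k + ->]|]; first by rewrite inE ffunE.
case: (unliftP ord0 j) => [k -> ltk|-> //]; exists k; rewrite ?ffunE // inE.
by move: ltk; rewrite /= /bump leq0n.
Qed.

(** * The symmetrized coefficients *)

Lemma alt_word_no_lB e s :
  alt_word e s -> count_mem lB s = 0%N ->
  ~~ has (fun l : letter => if e then l.1 else l.2) s.
Proof. by elim: s => [|[[] []] s IH] //=; case: e IH. Qed.

(** Without a B the state never changes, so one side of the word is empty. This gives
    [triangle_(-1) = 0] although [alt_coef 0] is not zero. *)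
Lemma alt_coef0_eq0 e s :
  has (fun l => l.1) s -> has (fun l => l.2) s -> alt_coef 0 e s = 0.
Proof.
rewrite /alt_coef => h1 h2; case: andP => // -[al /eqP cB].
by move: (alt_word_no_lB al cB); case: e {al}; rewrite ?h1 ?h2.
Qed.

Lemma swap_wordK : involutive swap_word.
Proof. by elim=> //= -[a b] s IH; rewrite -[in RHS]IH. Qed.

Definition sym_coefs i s : 'F_2 :=
  if i is 0 then alt_coef 1 false s + alt_coef 1 true s else 0.

Lemma coherent_sym_coefs : coherent sym_coefs.
Proof.
move=> [|[|i]] s h1 h2; rewrite ?wdiff0 ?addr0 //=.
  by rewrite wdiffD !wdiff_alt_coef /= !alt_coef0_eq0 ?addr0.
by rewrite !alt_coef_swap /=; ring: F2_two.
Qed.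

Lemma degen_compat_sym_coefs i : degen_compat (sym_coefs i).
Proof.
by case: i => [|i]; [apply: degen_compatD; apply: degen_compat_alt_coef
                    | apply: degen_compat0].
Qed.

(** * The twisted coefficients *)

Definition twist_word : seq letter := [:: lL; lL; lB; lB].

Definition twist s : 'F_2 := (s == twist_word)%:R.

Definition twisted_coefs i s : 'F_2 :=
  alt_coef i.+1 false s +
  match i with
  | 0 => wdiff twist s
  | 1 => twist s + twist (swap_word s)
  | _ => 0
  end.

(** For the added terms, degree 0 is the vanishing of the double boundary, degree 1 says that the
    boundary commutes with [T], and degree 2 is [(1 + T)^2 = 0]. *)
Lemma coherent_twisted_coefs : coherent twisted_coefs.
Proof.
move=> i s h1 h2; rewrite wdiffD wdiff_alt_coef.
case: i => [|[|[|i]]]; rewrite /twisted_coefs ?wdiff0 ?wdiff_wdiff.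
- by rewrite !alt_coef0_eq0 ?addr0.
- by rewrite wdiffD wdiff_swap alt_coef_swap; ring.
- by rewrite alt_coef_swap swap_wordK; ring: F2_two.
- by rewrite alt_coef_swap; ring.
Qed.

(** LLBB contains neither an O nor an L next to an R, and every word in a collapse contains one of
    these. *)
Lemma degen_compat_twist : degen_compat twist.
Proof.
move=> s1 l s2; case: s1 => [|? [|? [|? [|? s1]]]]; case: l => [[] []];
  rewrite /= /twist /twist_word ?eqseq_cons /= ?andbF ?addr0 //.
all: by case: s1 => [|? ?]; rewrite /= !andbF ?addr0.
Qed.

Lemma degen_compat_twisted_coefs i : degen_compat (twisted_coefs i).
Proof.
apply: degen_compatD; first exact: degen_compat_alt_coef.
case: i => [|[|i]]; last exact: degen_compat0.
  exact/degen_compat_wdiff/degen_compat_twist.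
by apply: degen_compatD; [|apply: degen_compat_swap]; apply: degen_compat_twist.
Qed.

(** A Boolean form of the recursion [wdiff_cons] for the indicator of [w], which makes the finite
    check computable. *)
Fixpoint wdiff_pred (w s : seq letter) {struct s} : bool :=
  if s is l :: t then
    (match l with
     | lO => (lL :: t == w) (+) (lR :: t == w) (+) (t == w)
     | lL | lR => lB :: t == w
     | lB => false
     end) (+) (if w is x :: w' then (l == x) && wdiff_pred w' t else false)
  else false.

Lemma F2_addb (a b : bool) : a%:R + b%:R = (a (+) b)%:R :> 'F_2.
Proof. by case: a; case: b; rewrite ?addr0 ?add0r // F2_addxx. Qed.

Lemma wdiff_pred_eq w s : wdiff (fun t => (t == w)%:R) s = (wdiff_pred w s)%:R.
Proof.
elim: s w => [|l s IH] w; first by rewrite wdiff_nil.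
rewrite wdiff_cons /= -F2_addb; congr (_ + _).
  by case: l => [[] []] //=; rewrite !F2_addb.
case: w => [|x w]; first by rewrite -[RHS](wdiff0 s); apply: eq_wdiff.
rewrite -mulnb natrM -IH -wdiffZ; apply: eq_wdiff => t.
by rewrite eqseq_cons -mulnb natrM.
Qed.

(** Filling a letter keeps the length, and deleting one lowers it by one. *)
Lemma wdiff_pred_size w s :
  wdiff_pred w s -> (size s == size w) || (size s == (size w).+1).
Proof.
elim: s w => [|l s IH] w //; apply: contraTT; rewrite negb_or => /andP[n1 n2].
have neqw t : size t != size w -> (t == w) = false.
  by apply: contraNF => /eqP ->.
have -> : wdiff_pred w (l :: s) = (if w is x :: w' then (l == x) && wdiff_pred
  w' s else false).
  by case: l {n1 n2} (n1) (n2) => [[] []] /= m1 m2; rewrite ?neqw.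
case: w n1 n2 {neqw} => // x w n1 n2; rewrite negb_and; apply/orP; right.
by apply: contra (IH w) _; rewrite -(eqSS (size s)) -(eqSS (size s) (size
  w).+1) negb_or n1 n2.
Qed.

Fixpoint words n : seq (seq letter) :=
  if n is n'.+1 then [seq l :: s | l <- [:: lO; lL; lR; lB], s <- words n']
  else [:: [::]].

Lemma mem_words n s : size s = n -> s \in words n.
Proof.
elim: n s => [|n IH] [|l s] // [/IH ins].
by apply: allpairs_f ins; case: l => [[] []].
Qed.

Definition asymmetric_at s :=
  let c t := (alt_word false t && (count_mem lB t == 1)) (+) wdiff_pred
    twist_word t in
  ~~ (c s && c (swap_word s)).

Lemma asymmetric_words : all asymmetric_at (words 4 ++ words 5).
Proof. by vm_compute. Qed.

Lemma twisted_coefs0E s : twisted_coefs 0 s =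
  ((alt_word false s && (count_mem lB s == 1)) (+) wdiff_pred twist_word s)%:R.
Proof. by rewrite /twisted_coefs /alt_coef wdiff_pred_eq F2_addb. Qed.

Lemma twisted_coefs_symmetric i s :
  twisted_coefs i s != 0 -> twisted_coefs i (swap_word s) != 0 -> s = nseq i.+1
    lB.
Proof.
have sizes t : wdiff_pred twist_word t -> t \in words 4 ++ words 5.
  by move/wdiff_pred_size/orP => [] /eqP e; rewrite mem_cat (mem_words e) ?orbT.
have alt k : alt_coef k false s != 0 -> alt_coef k false (swap_word s) != 0 ->
  s = nseq k lB.
  by rewrite alt_coef_swap; apply: alt_coef_symmetric.
case: i => [|[|i]]; last by rewrite /twisted_coefs !addr0; apply: alt.
  have [ins|nins] := boolP (s \in words 4 ++ words 5).
    have := allP asymmetric_words s ins; rewrite /asymmetric_at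
      !twisted_coefs0E.
    by case: (_ (+) _) => //=; case: (_ (+) _).
  have [ins|nins'] := boolP (swap_word s \in words 4 ++ words 5).
    have := allP asymmetric_words _ ins; rewrite /asymmetric_at swap_wordK
      !twisted_coefs0E.
    by case: (_ (+) _) => //=; case: (_ (+) _).
  move: (contraNF (sizes s) nins) (contraNF (sizes (swap_word s)) nins') => e1
    e2.
  rewrite /twisted_coefs /twist !wdiff_pred_eq e1 e2 !addr0; exact: alt.
rewrite /twisted_coefs swap_wordK /twist.
(* LLBB is itself canonical with two Bs, so in degree 1 the twist cancels it and puts its transpose
   RRBB in its place. *)
have [->|n1] := eqVneq s twist_word; first by move=> /eqP[]; apply: val_inj.
have [e|n2] := eqVneq (swap_word s) twist_word; last by rewrite !addr0;
  apply: alt.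
by rewrite e => _ /eqP[]; apply: val_inj.
Qed.

(** * The three constructions *)

Lemma ex_zero_construction : exists M : cupFamily,
  [/\ ss_construction M, is_simplicial M, is_irreducible M, is_free M &
      ~ isomorphic M canonical].
Proof.
pose c (i : nat) (s : seq letter) : 'F_2 := 0.
exists (family_of (coproducts_of c)); split.
- by apply: ss_construction_of => -[|i] s _ _; rewrite wdiff0 // addr0.
- by apply: is_simplicial_of => i; apply: degen_compat0.
- exact: is_irreducible_of.
- by apply: is_free_of => i s; rewrite eqxx.
exact: not_isomorphic_vertex.
Qed.

Lemma is_nonzero_of c i n p q (y : injMap p n) (z : injMap q n) :
  coproducts_of c i y z != 0 -> is_nonzero (family_of (coproducts_of c)).
Proof.
move=> /eqP nz M0; apply: nz.
have := congr1 (fun f => f (id_inj n)) (M0 (Delta n) i p q n F2S2_one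
  (dual_basis y) (dual_basis z)).
by rewrite family_of_id mul0r addr0 mul1r.
Qed.

Lemma ex_nonfree_construction : exists M : cupFamily,
  [/\ ss_construction M, is_simplicial M, is_nonzero M, is_irreducible M &
      ~ isomorphic M canonical].
Proof.
exists (family_of (coproducts_of sym_coefs)); split.
- exact/ss_construction_of/coherent_sym_coefs.
- exact/is_simplicial_of/degen_compat_sym_coefs.
(* The edge and its vertex 1 form the word LB, which is canonical in exactly one state. *)
- apply: (@is_nonzero_of _ 0%N 1%N 1%N 0%N (id_inj 1) (coface ord0)).
  rewrite /coproducts_of vset_coface0.
  have -> : vset (id_inj 1) = [set j : 'I_2 | predT (j : nat)].
    by rewrite vset_id; apply/setP => j; rewrite !inE.
  by rewrite word_of_nat.
- by apply: is_irreducible_of => -[|i] s //= Os; rewrite !alt_coef_lO ?addr0.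
(* The word B is canonical in both states, so its coefficient is [1 + 1 = 0]. *)
by apply: not_isomorphic_vertex; apply: val_inj.
Qed.

Lemma ex_reducible_construction : exists M : cupFamily,
  [/\ ss_construction M, is_simplicial M, is_nonzero M, is_free M &
      ~ isomorphic M canonical].
Proof.
exists (family_of (coproducts_of twisted_coefs)).
(* The faces [{1,2,3}] and [{2,3}] form the word OLBB; filling its O with L gives LLBB. *)
pose y : injMap 2 3 := coface ord0.
pose z : injMap 1 3 := comp_inj (coface ord0) (coface ord0).
have yz : coproducts_of twisted_coefs 0 y z = 1.
  rewrite /coproducts_of vset_coface0 vset_coface00 word_of_nat twisted_coefs0E
    /=.
  by rewrite mul1r.
split.
- exact/ss_construction_of/coherent_twisted_coefs.
- exact/is_simplicial_of/degen_compat_twisted_coefs.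
- by apply: (@is_nonzero_of _ 0%N 3%N 2%N 1%N y z); rewrite yz oner_eq0.
- exact/is_free_of/twisted_coefs_symmetric.
(* Evaluation at the preimage of [e_0] reads the coefficient 1 of OLBB on the twisted side, while
   the canonical coefficients vanish in both orders. *)
case=> phi phiW iso; have [psi _ psiK] := W_aut_bij phiW 0.
have := congr1 (fun f => f (id_inj 3))
  (iso (Delta 3) 0%N 2%N 1%N 3%N (psi F2S2_one) (dual_basis y) (dual_basis z)).
have jy : ord0 \notin vset y by rewrite vset_coface0 inE.
have jz : ord0 \notin vset z by rewrite vset_coface00 inE.
rewrite psiK /canonical !family_of_id yz.
rewrite (canonical_coproducts_cover _ jy jz) (canonical_coproducts_cover _ jz
  jy).
by rewrite !mulr0 mul0r !addr0 mulr1 => /eqP; rewrite oner_eq0.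
Qed.

Theorem mainTheorem2 :
  (exists M : cupFamily,
     [/\ ss_construction M, is_simplicial M, is_irreducible M, is_free M &
         ~ isomorphic M canonical]) /\
  (exists M : cupFamily,
     [/\ ss_construction M, is_simplicial M, is_nonzero M, is_free M &
         ~ isomorphic M canonical]) /\
  (exists M : cupFamily,
     [/\ ss_construction M, is_simplicial M, is_nonzero M, is_irreducible M &
         ~ isomorphic M canonical]).
Proof.
split; first exact: ex_zero_construction.
by split; [apply: ex_reducible_construction | apply: ex_nonfree_construction].
Qed.
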